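(* Let $\Omega\subset\mathbb{R}^d$ be open and bounded and let $V$ be a real Banach space. Assume that the norm $\|\cdot\|_{(V^* )^d}$ on $(V^* )^d$ used in the definition of $\operatorname{TV}_V$ satisfies the rotational invariance property $$\|p\|_{(V^* )^d} = \|Rp\|_{(V^* )^d}\qquad\forall p\in(V^* )^d,\ R\in SO(d),$$ where $Rp\in(V^* )^d$ is defined via $(Rp)_i := \sum_{j=1}^dR_{ij}p_j\in V^*$. Then $\operatorname{TV}_V$ is rotationally invariant, i.e., $\operatorname{TV}_V(u)=\operatorname{TV}_V(\tilde u)$ whenever $u\in L_w^\infty(\Omega,V)$ and $\tilde u(x) := u(Rx)$ for some $R\in SO(d)$, where $\tilde u$ is defined on the rotated domain $R^T\Omega := \{R^Tx : x\in\Omega\}$ and $\operatorname{TV}_V(\tilde u)$ is taken with respect to $R^T\Omega$.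
   Context: $V^*$ is the topological dual of $V$ and $\langle p,v\rangle := p(v)$. A function $u\colon\Omega\to V$ is weakly measurable if $x\mapsto\langle p,u(x)\rangle$ is Lebesgue measurable for each $p\in V^*$; $L_w^\infty(\Omega,V)$ is the set of weakly measurable $u$ with $\operatorname{ess\,sup}_{x\in\Omega}\|u(x)\|_V<\infty$. For weakly measurable $u\colon\Omega\to V$, $$\operatorname{TV}_V(u) := \sup\left\{\int_\Omega\langle-\operatorname{div}p(x),u(x)\rangle\,dx : p\in C_c^1(\Omega,(V^* )^d),\ \|p(x)\|_{(V^* )^d}\le 1\ \forall x\in\Omega\right\},$$ where $\operatorname{div}p(x) := \sum_{i=1}^d\partial_ip_i(x)$, and $p\in C_c^1(\Omega,(V^* )^d)$ means that $p$ is compactly supported in $\Omega$ with values in the Banach space $(V^* )^d$ and its partial derivatives $\partial_ip\colon\Omega\to(V^* )^d$, $1\le i\le d$, exist and are continuous with compact support. The norm $\|\cdot\|_{(V^* )^d}$ is a product norm, i.e. it induces the product topology on $(V^* )^d$. For a function defined on another open bounded domain, $\operatorname{TV}_V$ is defined by the same formula with $\Omega$ replaced by that domain. *)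

(* Defs.v *)
From HB Require Import structures.
From mathcomp Require Import all_boot all_order all_algebra.
From mathcomp Require Import all_classical all_reals all_analysis.
From mathcomp Require Import ess_sup_inf.
Import Order.TTheory GRing.Theory Num.Theory.
Import numFieldNormedType.Exports.

Set Implicit Arguments.
Unset Strict Implicit.
Unset Printing Implicit Defensive.

Local Open Scope classical_set_scope.
Local Open Scope ring_scope.

Section dual.
Context {R : realType} (V : normedModType R).

Definition dual_pred : {pred V -> R^o} :=
  mem [set f : V -> R^o | linear f /\ continuous f].

Record dual := Dual { dual_fun :> V -> R^o ; dual_funP : dual_fun \in dual_pred }.

HB.instance Definition _ := [isSub for dual_fun].
HB.instance Definition _ := [Choice of dual by <:].

Lemma dual_submod_closed : submod_closed dual_pred.
Proof.
split.
  rewrite inE/=; split; last exact: cst_continuous.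
  by move=> a x y; rewrite /= scaler0 addr0.
move=> a f g; rewrite !inE/= => -[lf cf] [lg cg]; split.
  move=> b x y; rewrite -[LHS]/(a *: f (b *: x + y) + g (b *: x + y)) lf lg.
  rewrite -[RHS]/(b *: (a *: f x + g x) + (a *: f y + g y)).
  by rewrite !scalerDr !scalerA (mulrC a) addrACA.
move=> x; apply: (@continuousD _ _ _ (a *: f) g) .
  exact: (@continuousZl_tmp _ _ _ f a x (cf x)).
exact: cg.
Qed.

HB.instance Definition _ := GRing.isSubmodClosed.Build R (V -> R^o) dual_pred
  dual_submod_closed.
HB.instance Definition _ := [SubChoice_isSubLmodule of dual by <:].


Lemma dual_linear (p : dual) : linear (p : V -> R^o).
Proof. by have := dual_funP p; rewrite inE => -[]. Qed.

HB.instance Definition _ (p : dual) :=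
  GRing.isLinear.Build R V R^o _ (dual_fun p) (dual_linear p).

Lemma dual_continuous (p : dual) : continuous (p : V -> R^o).
Proof. by have := dual_funP p; rewrite inE => -[]. Qed.

Lemma dualD (p q : dual) v : (p + q) v = p v + q v.
Proof. by []. Qed.

Lemma dualZ a (p : dual) v : (a *: p) v = a * p v.
Proof. by []. Qed.

Definition dual_norm (p : dual) : R :=
  sup [set `|p v| | v in [set v : V | `|v| <= 1]].

Lemma dual_has_sup (p : dual) :
  has_sup [set `|p v| | v in [set v : V | `|v| <= 1]].
Proof.
split; first by exists `|p 0|, 0 => //=; rewrite normr0.
have /linear_bounded_continuous/linear_boundedP := @dual_continuous p.
move=> /pinfty_ex_gt0[M M0 pM]; exists M => _ [v /= v1 <-].
by rewrite (le_trans (pM v))// ler_piMr// ltW.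
Qed.

Lemma dual_norm_ub (p : dual) v : `|v| <= 1 -> `|p v| <= dual_norm p.
Proof.
by move=> v1; apply: sup_upper_bound; [exact: dual_has_sup|exists v].
Qed.

Lemma dual_norm_le (p : dual) M :
  (forall v, `|v| <= 1 -> `|p v| <= M) -> dual_norm p <= M.
Proof.
move=> pM; apply: ge_sup; first by have [] := dual_has_sup p.
by move=> _ [v /= v1 <-]; exact: pM.
Qed.

Lemma dual_normD (p q : dual) : dual_norm (p + q) <= dual_norm p + dual_norm q.
Proof.
apply: dual_norm_le => v v1; rewrite dualD (le_trans (ler_normD _ _))//.
by rewrite lerD// dual_norm_ub.
Qed.

Lemma dual_normZ a (p : dual) : dual_norm (a *: p) = `|a| * dual_norm p.
Proof.
have norm_le b q : dual_norm (b *: q) <= `|b| * dual_norm q.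
  apply: dual_norm_le => v v1.
  by rewrite dualZ normrM ler_wpM2l// dual_norm_ub.
apply/eqP; rewrite eq_le norm_le/=.
have [->|a0] := eqVneq a 0.
  have := @dual_norm_ub (0 *: p) 0; rewrite (@normr0 _ V) => /(_ ler01).
  by rewrite normr0 mul0r; exact: le_trans.
rewrite -ler_pdivlMl ?normr_gt0// -normfV.
by rewrite -{1}(scalerK a0 p) norm_le.
Qed.

Lemma dual_norm0_eq0 (p : dual) : dual_norm p = 0 -> p = 0.
Proof.
move=> p0; apply/val_inj/funext => v; apply/eqP; change (p v == 0 :> R).
have [->|v0] := eqVneq v 0; first by rewrite linear0.
have := @dual_norm_ub p (`|v|^-1 *: v).
rewrite p0 normrZ normfV normr_id mulVf ?normr_eq0// => /(_ (lexx _)).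
by rewrite normr_le0 linearZ/= mulf_eq0 invr_eq0 normr_eq0 (negbTE v0).
Qed.

HB.instance Definition _ := @Lmodule_isNormed.Build R dual dual_norm
  dual_normD dual_normZ dual_norm0_eq0.

End dual.

Section dual_pow.
Context {R : realType} (V : normedModType R) (d : nat).

(* The d-fold power of the dual. The maximum norm only serves to make the product
   topology ([nbhs_dual_pow]) that of a normed module, as needed for derivatives;
   the norm bounding the test fields is the argument [N] of [TV]. *)
Definition dual_pow := 'I_d -> dual V.

HB.instance Definition _ := GRing.Lmodule.on dual_pow.

Definition dual_pow_norm (p : dual_pow) : R := \big[Num.max/0]_(i < d) `|p i|.

Lemma dual_pow_norm_le (p : dual_pow) M : 0 <= M ->
  dual_pow_norm p <= M <-> forall i, `|p i| <= M.
Proof.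
move=> M0; split=> [pM i|pM].
  by rewrite (le_trans _ pM)// /dual_pow_norm (bigmax_sup i).
by apply: bigmax_le.
Qed.

Lemma dual_pow_norm_ge0 (p : dual_pow) : 0 <= dual_pow_norm p.
Proof. by rewrite /dual_pow_norm bigmax_ge_id. Qed.

Lemma dual_pow_norm_ub (p : dual_pow) i : `|p i| <= dual_pow_norm p.
Proof. exact: (iffLR (dual_pow_norm_le p (dual_pow_norm_ge0 p))). Qed.

Lemma dual_pow_normD (p q : dual_pow) :
  dual_pow_norm (p + q) <= dual_pow_norm p + dual_pow_norm q.
Proof.
apply: (iffRL (dual_pow_norm_le _ _)); first by rewrite addr_ge0 ?dual_pow_norm_ge0.
by move=> i; rewrite (le_trans (ler_normD _ _))// lerD ?dual_pow_norm_ub.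
Qed.

Lemma dual_pow_normZ a (p : dual_pow) :
  dual_pow_norm (a *: p) = `|a| * dual_pow_norm p.
Proof.
have norm_le b q : dual_pow_norm (b *: q) <= `|b| * dual_pow_norm q.
  apply: (iffRL (dual_pow_norm_le _ _)).
    by rewrite mulr_ge0 ?dual_pow_norm_ge0.
  by move=> i; rewrite normrZ ler_wpM2l ?dual_pow_norm_ub.
apply/eqP; rewrite eq_le norm_le/=.
have [->|a0] := eqVneq a 0; first by rewrite normr0 mul0r dual_pow_norm_ge0.
rewrite -ler_pdivlMl ?normr_gt0// -normfV.
by rewrite -{1}(scalerK a0 p) norm_le.
Qed.

Lemma dual_pow_norm0_eq0 (p : dual_pow) : dual_pow_norm p = 0 -> p = 0.
Proof.
move=> p0; apply/funext => i; apply/eqP.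
by rewrite -normr_le0 (le_trans (dual_pow_norm_ub p i))// p0.
Qed.

HB.instance Definition _ := @Lmodule_isNormed.Build R dual_pow dual_pow_norm
  dual_pow_normD dual_pow_normZ dual_pow_norm0_eq0.

Lemma nbhs_dual_pow (p : dual_pow) :
  nbhs p = nbhs (p : {ptws 'I_d -> dual V}).
Proof.
apply/seteqP; split => A.
  rewrite nbhs_ballP => -[e/= e0 pA].
  have H i : \forall q \near (p : {ptws 'I_d -> dual V}), `|p i - q i| < e / 2.
    pose T : 'I_d -> topologicalType := fun=> dual V.
    have h := @proj_continuous _ T i p.
    have e2 : 0 < e / 2 by rewrite divr_gt0.
    have := h _ (nbhsx_ballx (p i) _ e2).
    by rewrite -ball_normE.
  have := (@filter_forall _ _ (fun i => [set q : dual_pow| `|p i - q i| < e / 2]) _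
        (@nbhs_filter {ptws 'I_d -> dual V} p) H).
  apply: (@filterS _ _ (@nbhs_filter {ptws 'I_d -> dual V} p)) => q pq.
  apply: pA; rewrite -ball_normE/=.
  apply: (@le_lt_trans _ _ (e / 2)); last by rewrite ltr_pdivrMr// ltr_pMr// ltr1n.
  apply: (iffRL (dual_pow_norm_le _ _)) => [|i]; last exact/ltW/pq.
  by rewrite ltW// divr_gt0.
pose T : 'I_d -> topologicalType := fun=> dual V.
have : nbhs p --> (p : prod_topology T).
  apply/cvg_sup => i B.
  move=> [B0 [[U Uo <-] Up] B0B].
  have : nbhs (p i) U by apply: open_nbhs_nbhs.
  rewrite nbhs_ballP => -[e/= e0 pU].
  have : nbhs p [set q | `|p - q| < e].
    by have := nbhsx_ballx p e e0; rewrite -ball_normE.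
  apply: (@filterS _ _ (@nbhs_filter dual_pow p)) => q /= pq.
  apply: B0B; apply: pU; rewrite -ball_normE/=.
  exact: le_lt_trans (dual_pow_norm_ub (p - q) i) pq.
exact.
Qed.

End dual_pow.

(* Lebesgue measure on R^d: Caratheodory's construction applied to the outer
   measure given by countable covers by half-open boxes; its measurable sets are
   the Lebesgue measurable sets. Covers are indexed by countable sets of boxes
   rather than by sequences, so that the empty cover is allowed. *)
Section lebesgue.
Local Open Scope ereal_scope.
Context (R : realType) (d : nat).

Definition box (ab : 'cV[R]_d * 'cV[R]_d) : set 'cV[R]_d :=
  [set x | forall i, (ab.1 i 0 < x i 0 <= ab.2 i 0)%R].

Definition box_volume (ab : 'cV[R]_d * 'cV[R]_d) : R :=
  \prod_(i < d) Num.max 0%R (ab.2 i 0 - ab.1 i 0)%R.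

Definition box_cover (X : set 'cV[R]_d) : set (set ('cV[R]_d * 'cV[R]_d)) :=
  [set B | countable B /\ X `<=` \bigcup_(ab in B) box ab].

Definition lebesgue_outer (X : set 'cV[R]_d) : \bar R :=
  ereal_inf [set \esum_(ab in B) (box_volume ab)%:E | B in box_cover X].

Lemma box_volume_ge0 ab : 0 <= (box_volume ab)%:E.
Proof. by rewrite lee_fin prodr_ge0// => i _; rewrite le_max lexx. Qed.

Lemma lebesgue_outer_ge0 X : 0 <= lebesgue_outer X.
Proof.
apply: le_ereal_inf_tmp => _ [B _ <-].
by apply: esum_ge0 => ab _; exact: box_volume_ge0.
Qed.

Lemma lebesgue_outer0 : lebesgue_outer set0 = 0.
Proof.
apply/eqP; rewrite eq_le lebesgue_outer_ge0 andbT.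
apply: ereal_inf_lbound; exists set0; last by rewrite esum_set0.
by split; [exact: countable0|exact: sub0set].
Qed.

Lemma le_lebesgue_outer : {homo lebesgue_outer : A B / A `<=` B >-> A <= B}.
Proof.
move=> X Y XY; apply: ereal_inf_le_tmp => _ [B [cB YB] <-]; exists B => //.
by split => //; exact: subset_trans YB.
Qed.

Lemma lebesgue_outer_sigma_subadditive : sigma_subadditive lebesgue_outer.
Proof.
move=> F; have [[i Fi]|] := pselect (exists i, lebesgue_outer (F i) = +oo).
  rewrite (eseries_pinfty _ _ Fi) ?leey// => n _.
  by rewrite -ltNye (lt_le_trans _ (lebesgue_outer_ge0 _)).
rewrite -forallNE => Foo; apply/lee_addgt0Pr => e e0.
apply: le_trans (epsilon_trick xpredT _ (ltW e0)); last first.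
  by move=> n; exact: lebesgue_outer_ge0.
have /choice[B FB] n : exists B, box_cover (F n) B /\
    \esum_(ab in B) (box_volume ab)%:E <=
    lebesgue_outer (F n) + (e / (2 ^ n.+1)%:R)%:E.
  have en : (0 < e / (2 ^ n.+1)%:R)%R.
    by rewrite divr_gt0// ltr0n expn_gt0.
  have : lebesgue_outer (F n) \is a fin_num.
    by rewrite ge0_fin_numE ?lebesgue_outer_ge0// ltey; exact/eqP.
  by move=> /(lb_ereal_inf_adherent en)[_ [B FB <-] /ltW]; exists B.
apply: (@le_trans _ _
    (\esum_(ab in \bigcup_n B n) (box_volume ab)%:E)).
  apply: ereal_inf_lbound; exists (\bigcup_n B n) => //; split.
    by apply: bigcup_countable => // n _; exact: (FB n).1.1.
  move=> x [n _ Fnx]; have [ab Bab abx] := (FB n).1.2 _ Fnx.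
  by exists ab => //; exists n.
rewrite seqDU_bigcup_eq esum_bigcupT; last 2 first.
- exact: trivIset_seqDU.
- by move=> ab; exact: box_volume_ge0.
rewrite -nneseries_esumT; last first.
  by move=> n; apply: esum_ge0 => ab _; exact: box_volume_ge0.
apply: lee_nneseries => [n _ _|n _].
  by apply: esum_ge0 => ab _; exact: box_volume_ge0.
apply: le_trans (FB n).2.
apply: ge_ereal_sup => _ [X [finX XB] <-]; apply: esum_ge; exists X => //.
by split => //; exact: subset_trans (@subset_seqDU _ _ _).
Qed.

HB.instance Definition _ := isOuterMeasure.Build R 'cV[R]_d lebesgue_outer
  lebesgue_outer0 lebesgue_outer_ge0 le_lebesgue_outer
  lebesgue_outer_sigma_subadditive.

Definition lebesgue_space := caratheodory_type lebesgue_outer.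

HB.instance Definition _ := Measurable.on lebesgue_space.

Definition lebesgue : set lebesgue_space -> \bar R := lebesgue_outer.

HB.instance Definition _ := isMeasure.Build _ lebesgue_space R lebesgue
  (@caratheodory_measure0 R _ lebesgue_outer)
  (@caratheodory_measure_ge0 R _ lebesgue_outer)
  (@caratheodory_measure_sigma_additive R _ lebesgue_outer).

Lemma lebesgue_complete : measure_is_complete lebesgue.
Proof. exact: measure_is_complete_caratheodory. Qed.

End lebesgue.
Arguments lebesgue {R} d _.

Section total_variation.
Context {R : realType} {d : nat} {V : normedModType R}.
Implicit Types (Omega : set 'cV[R]_d) (u : 'cV[R]_d -> V)
  (p : 'cV[R]_d -> dual_pow V d) (N : dual_pow V d -> R).

(* Functions on Omega are represented by total functions; every definition below
   depends only on their values on Omega (which is always open). *)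

Definition weakly_measurable Omega u := forall q : dual V,
  measurable_fun (Omega : set (lebesgue_space R d)) (fun x => q (u x) : R).

Definition Lw_infty Omega : set ('cV[R]_d -> V) := [set u |
  weakly_measurable Omega u /\
  (ess_sup (lebesgue d) ((fun x => `|u x|%:E) \_ Omega) < +oo)%E].

Definition compactly_supported (W : normedModType R) Omega (f : 'cV[R]_d -> W) :=
  let S := closure (Omega `&` [set x | f x != 0]) in compact S /\ S `<=` Omega.

Definition std_basis (i : 'I_d) : 'cV[R]_d := delta_mx i 0.

Definition C1c Omega : set ('cV[R]_d -> dual_pow V d) := [set p |
  compactly_supported Omega p /\
  forall i, [/\ forall x, Omega x -> derivable p x (std_basis i),
    forall x, Omega x -> {for x, continuous (fun y => 'D_(std_basis i) p y)} &
    compactly_supported Omega (fun y => 'D_(std_basis i) p y)]].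

Definition divergence p (x : 'cV[R]_d) : dual V :=
  \sum_(i < d) 'D_(std_basis i) (fun y => p y i) x.

Definition TV N Omega u : \bar R := ereal_sup
  [set (\int[lebesgue d]_(x in Omega) ((- divergence p x) (u x))%:E)%E |
    p in [set p | C1c Omega p /\ forall x, Omega x -> N (p x) <= 1]].

(* A norm inducing the product topology. *)
Definition product_norm N := [/\
  forall p q : dual_pow V d, N (p + q) <= N p + N q,
  forall (a : R) (p : dual_pow V d), N (a *: p) = `|a| * N p,
  forall p : dual_pow V d, N p = 0 -> p = 0 &
  forall (p : dual_pow V d) (A : set (dual_pow V d)),
    nbhs (p : {ptws 'I_d -> dual V}) A <->
    exists2 e : R, 0 < e & [set q | N (q - p) < e] `<=` A].

Definition rot_dual (Q : 'M[R]_d) (p : dual_pow V d) : dual_pow V d :=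
  fun i => \sum_(j < d) Q i j *: p j.

End total_variation.

Definition SO {R : realType} {d : nat} : set 'M[R]_d :=
  [set Q | Q *m Q^T = 1%:M /\ \det Q = 1].

(* Main.v *)
Require Import Defs.
From HB Require Import structures.
From mathcomp Require Import all_boot all_order all_algebra.
From mathcomp Require Import all_classical all_reals all_analysis.
From mathcomp Require Import ring lra.
Import Order.TTheory GRing.Theory Num.Theory.
Import numFieldNormedType.Exports.

Set Implicit Arguments.
Unset Strict Implicit.
Unset Printing Implicit Defensive.

Local Open Scope classical_set_scope.
Local Open Scope ring_scope.

(** Lebesgue outer measure [mu] is invariant under an orthogonal matrix [Q]:
    chopping boxes into small cubes and using the translation invariance and
    homogeneity of [mu], one gets [mu (Q X) <= c * mu X], where [c] is the ratio
    [mu (Q C) / mu C] for a cube [C]. Since [Q] fixes the unit ball, removing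
    the ball from a cube shows that [c <= 1]. Hence integrals are invariant under
    [x |-> Q x]. A test field [p] on [Omega] is then turned into the test field
    [y |-> Q^T p (Q y)] on [Q^T Omega], which satisfies the same norm bound and
    whose divergence at [y] is [div p (Q y)], so that [TV] cannot decrease; the
    same applied to [Q^T] gives the equality. *)

(** * Lebesgue outer measure of linear images *)

Section outer_measure.
Local Open Scope ereal_scope.
Context (R : realType).

Lemma outer_measure_bigcup_le_esum (T : Type) (I : choiceType)
    (mu : {outer_measure set T -> \bar R}) (B : set I) (F : I -> set T) :
  countable B -> mu (\bigcup_(i in B) F i) <= \esum_(i in B) mu (F i).
Proof.
move=> cB; have mu0 i : 0 <= mu (F i) by exact: outer_measure_ge0.
have [->|/set0P[i0 Bi0]] := eqVneq B set0.
  by rewrite bigcup_set0 outer_measure0 esum_set0.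
have /countable_bijP[A] := cB; rewrite card_eq_sym => /card_bijP[f bf].
pose e n : I :=
  if pselect (A n) is left An then sval (f (exist _ n (mem_set An))) else i0.
have bij_e : set_bij A B e.
  split.
  - move=> n An; rewrite /e; case: pselect => // An'.
    by case: (f _) => /= y /set_mem.
  - move=> n m /set_mem An /set_mem Am; rewrite /e; case: pselect => // An'.
    case: pselect => // Am' /val_inj fnm.
    by have [g fK gK] := bf; have /(congr1 g) := fnm; rewrite !fK => -[].
  - move=> y By; have [g fK gK] := bf.
    pose z := g (exist _ y (mem_set By)); have Az : A (sval z) by case: z => /= n /set_mem.
    exists (sval z) => //; rewrite /e; case: pselect => // Az'.
    rewrite (_ : exist _ _ _ = z) /z ?gK//.
    by apply: val_inj.
rewrite (reindex_esum A B e)//.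
pose G n := if n \in A then F (e n) else set0.
have -> : \bigcup_(i in B) F i = \bigcup_n G n.
  apply/seteqP; split => [x [i Bi Fix]|x [n _]].
    have [_ _ /(_ i Bi)[n An eni]] := bij_e.
    by exists n => //; rewrite /G mem_set// eni.
  rewrite /G; case: ifPn => // /set_mem An Fx; exists (e n) => //.
  by have [h _ _] := bij_e; exact: h.
apply: le_trans (outer_measure_sigma_subadditive mu G) _.
rewrite nneseries_esumT; last by move=> n; exact: outer_measure_ge0.
rewrite [leRHS]esum_mkcond; apply: le_esum => n _; rewrite /G.
by case: ifP => //; rewrite outer_measure0.
Qed.

Lemma esumZl_le (T : choiceType) (A : set T) (a : T -> \bar R) (c : R) :
  (0 <= c)%R -> (forall i, 0 <= a i) ->
  \esum_(i in A) (c%:E * a i) <= c%:E * \esum_(i in A) a i.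
Proof.
move=> c0 a0; apply: ge_ereal_sup => _ [X [finX XA] <-].
rewrite -ge0_mule_fsumr// lee_wpmul2l ?lee_fin//.
by apply: ereal_sup_ubound; exists X.
Qed.

End outer_measure.

Section boxes.
Context (R : realType) (d : nat).
Implicit Types (X : set 'cV[R]_d) (ab : 'cV[R]_d * 'cV[R]_d).

Lemma lebesgue_outer_box ab : (lebesgue_outer (box ab) <= (box_volume ab)%:E)%E.
Proof.
apply: ereal_inf_lbound; exists [set ab].
  split; first exact: countable1.
  by rewrite bigcup_set1.
by rewrite esum_set1// box_volume_ge0.
Qed.

Lemma lebesgue_outer_image (f : 'cV[R]_d -> 'cV[R]_d) (c : R) : 0 < c ->
  (forall ab, (lebesgue_outer (f @` box ab) <= (c * box_volume ab)%:E)%E) ->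
  forall X, (lebesgue_outer (f @` X) <= c%:E * lebesgue_outer X)%E.
Proof.
move=> c0 fbox X; rewrite -lee_pdivrMl//.
apply: le_ereal_inf_tmp => _ [B [cB XB] <-]; rewrite lee_pdivrMl//.
apply: le_trans (esumZl_le _ (ltW c0) (@box_volume_ge0 _ _)).
apply: (@le_trans _ _ (lebesgue_outer (\bigcup_(ab in B) (f @` box ab)))).
  apply: le_lebesgue_outer => _ [x /XB[ab Bab abx] <-].
  by exists ab => //; exists x.
apply: le_trans (outer_measure_bigcup_le_esum _ _ cB) _.
by apply: le_esum => ab _; exact: fbox.
Qed.

Lemma image_affine_box (s : R) (t : 'cV[R]_d) ab : 0 < s ->
  [set s *: x + t | x in box ab] = box (s *: ab.1 + t, s *: ab.2 + t).
Proof.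
move=> s0; apply/seteqP; split => [_ [x abx <-] i /=|x /= abx].
  by rewrite !mxE ltrD2r lerD2r ltr_pM2l// ler_pM2l.
exists (s^-1 *: (x - t)); last by rewrite scalerA mulfV ?gt_eqF// scale1r subrK.
move=> i; have /= := abx i; rewrite !mxE.
by rewrite ler_pdivrMl// ltr_pdivlMl// lerBlDr ltrBrDr.
Qed.

Lemma box_volume_affine (s : R) (t : 'cV[R]_d) ab : 0 < s ->
  box_volume (s *: ab.1 + t, s *: ab.2 + t) = s ^+ d * box_volume ab.
Proof.
move=> s0; rewrite /box_volume /= -[in s ^+ d](card_ord d) -prodr_const -big_split/=.
apply: eq_bigr => i _; rewrite !mxE maxr_pMr ?ltW// mulr0 mulrBr.
by congr Num.max; ring.
Qed.

Lemma lebesgue_outer_affine (s : R) (t : 'cV[R]_d) X : 0 < s ->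
  (lebesgue_outer [set (s *: x + t)%R | x in X] <= (s ^+ d)%:E * lebesgue_outer X)%E.
Proof.
move=> s0; apply: lebesgue_outer_image; first exact: exprn_gt0.
move=> ab; rewrite image_affine_box// -(box_volume_affine t ab s0).
exact: lebesgue_outer_box.
Qed.

Definition centered_cube : set 'cV[R]_d := box (const_mx (-1), const_mx 1).

Lemma box_volume_centered_cube :
  box_volume (const_mx (-1) : 'cV[R]_d, const_mx 1 : 'cV[R]_d) = 2 ^+ d.
Proof.
rewrite /box_volume (eq_bigr (fun=> 2)) ?prodr_const ?card_ord// => i _.
by rewrite !mxE opprK max_r.
Qed.

Lemma grid_coordinate (h y : R) : 0 < h -> 0 < y ->
  exists k : nat, h * k%:R < y <= h * k%:R + h.
Proof.
move=> h0 y0; have yh0 : 0 < y / h by rewrite divr_gt0.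
have /ex_minnP[n yn nmin] : exists n, y / h <= n%:R.
  by exists (Num.trunc (y / h)).+1; rewrite ltW// truncnS_gt.
case: n yn nmin => [|n] yn nmin; first by move: yn; rewrite leNgt yh0.
exists n; apply/andP; split.
  rewrite mulrC -ltr_pdivlMr// ltNge; apply/negP => /nmin.
  by rewrite ltnn.
by move: yn; rewrite ler_pdivrMr// -natr1 mulrDl mul1r mulrC.
Qed.

End boxes.

Section linear_images.
Context (R : realType) (d : nat).
Implicit Types (X : set 'cV[R]_d) (M : 'M[R]_d).

Lemma box_grid (a b : 'cV[R]_d) (h : R) : 0 < h -> (forall i, a i 0 < b i 0) ->
  exists (n : nat) (K : {set {ffun 'I_d -> 'I_n}}),
    h ^+ d *+ #|K| <= \prod_(i < d) (b i 0 - a i 0 + h) /\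
    box (a, b) `<=` \bigcup_(k in [set` K])
      [set (h / 2) *: x + (a + \col_i (h * (k i)%:R + h / 2)) |
        x in @centered_cube R d].
Proof.
move=> h0 ab; pose m i := (Num.trunc ((b i 0 - a i 0) / h)).+1.
pose n := \max_i m i; pose Q i : pred 'I_n := fun k => (k < m i)%N.
exists n, [set k | k \in family Q]%SET; split.
  have -> : h ^+ d *+ #|[set k | k \in family Q]%SET| = \prod_(i < d) (h *+ m i).
    rewrite cardsE -sumr_const.
    transitivity (\sum_(k in family Q) \prod_(i < d) h).
      by apply: eq_bigr => k _; rewrite prodr_const card_ord.
    rewrite -(bigA_distr_big_dep _ (fun _ _ => h)); apply: eq_bigr => i _.
    have mn : (m i <= n)%N by exact: leq_bigmax.
    by rewrite -(big_ord_widen _ (fun=> h) mn) sumr_const card_ord.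
  apply: ler_prod => i _; rewrite mulrn_wge0 ?(ltW h0)//= mulrSr lerD2r -mulr_natr.
  rewrite mulrC -ler_pdivlMr//.
  by rewrite truncn_le// divr_ge0 ?ltW// subr_gt0.
move=> x abx.
have /choice[k kP] i : exists k : 'I_n, Q i k /\
    h * k%:R < x i 0 - a i 0 <= h * k%:R + h.
  have /= /andP[ax xb] := abx i; have y0 : 0 < x i 0 - a i 0 by rewrite subr_gt0.
  have [k /andP[hk kh]] := grid_coordinate h0 y0.
  have km : (k < m i)%N.
    rewrite ltnS truncn_ge_nat; last by rewrite divr_ge0 ?subr_ge0 ?(ltW h0) ?(ltW (ab i)).
    by rewrite ltW// ltr_pdivlMr// mulrC (lt_le_trans hk)// lerD2r.
  have kn : (k < n)%N by apply: leq_trans km _; exact: leq_bigmax.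
  by exists (Ordinal kn); split => //=; rewrite hk.
exists (finfun k).
  by rewrite /= inE; apply/familyP => i; rewrite ffunE; exact: (kP i).1.
have h2 : 0 < h / 2 by rewrite divr_gt0.
rewrite /centered_cube image_affine_box// => i; rewrite !mxE ffunE.
have [_ /andP[]] := kP i; rewrite ltrBrDl lerBlDl => hx xh.
by apply/andP; split; [apply: le_lt_trans hx|apply: le_trans xh _]; lra.
Qed.

Lemma prod_shift_cvg (F : 'I_d -> R) :
  \prod_(i < d) (F i + h) @[h --> 0] --> \prod_(i < d) F i.
Proof.
pose P : {poly R} := \prod_(i < d) ((F i)%:P + 'X).
have PE : horner P = fun h => \prod_(i < d) (F i + h).
  apply/funext => h; rewrite /P horner_prod; apply: eq_bigr => i _.
  by rewrite hornerD hornerC hornerX.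
have := @continuous_horner _ P 0; rewrite /continuous_at PE.
by under [X in _ --> X]eq_bigr do rewrite addr0.
Qed.

Lemma lebesgue_outer_mulmx_box M (k : R) (ab : 'cV[R]_d * 'cV[R]_d) :
  (lebesgue_outer (mulmx M @` @centered_cube R d) <= (k * 2 ^+ d)%:E)%E ->
  (lebesgue_outer (mulmx M @` box ab) <= (k * box_volume ab)%:E)%E.
Proof.
move=> Mk.
have k0 : 0 <= k.
  have := le_trans (lebesgue_outer_ge0 _) Mk.
  by rewrite lee_fin pmulr_lge0// exprn_gt0.
have [abP|/existsNP[i abi]] := pselect (forall i, ab.1 i 0 < ab.2 i 0); last first.
  rewrite (_ : box ab = set0) ?image_set0 ?lebesgue_outer0//.
    by rewrite lee_fin mulr_ge0// -lee_fin box_volume_ge0.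
  apply/seteqP; split => // x /(_ i) /andP[a b]; apply: abi.
  exact: lt_le_trans a b.
pose P h := k * \prod_(i < d) (ab.2 i 0 - ab.1 i 0 + h).
have bound h : 0 < h -> (lebesgue_outer (mulmx M @` box ab) <= (P h)%:E)%E.
  move=> h0; have h2 : 0 < h / 2 by rewrite divr_gt0.
  have [n [K [cK sub]]] := box_grid h0 abP.
  rewrite [ab]surjective_pairing.
  pose F (q : {ffun 'I_d -> 'I_n}) := [set (h / 2) *: x +
    M *m (ab.1 + \col_i (h * (q i)%:R + h / 2)) | x in mulmx M @` @centered_cube R d].
  apply: (@le_trans _ _ (lebesgue_outer (\bigcup_(q in [set` K]) F q))).
    apply: le_lebesgue_outer => _ [_ /sub [q Kq [x Cx <-]] <-].
    exists q => //; exists (M *m x); first by exists x.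
    by rewrite [RHS]mulmxDr scalemxAr.
  apply: le_trans (outer_measure_bigcup_le_esum _ _ (countable_finpred _)) _.
  apply: (@le_trans _ _ (\esum_(q in [set` K]) (k * h ^+ d)%:E)%E).
    apply: le_esum => q _; apply: le_trans (lebesgue_outer_affine _ _ h2) _.
    apply: le_trans (lee_wpmul2l _ Mk) _; first by rewrite lee_fin exprn_ge0// ltW.
    by rewrite -EFinM lee_fin expr_div_n mulrCA divfK ?gt_eqF ?exprn_gt0.
  rewrite esum_fset; last 2 first.
    exact: finite_finpred.
    by move=> q _; rewrite lee_fin mulr_ge0// exprn_ge0// ltW.
  rewrite (_ : [set` K] = [set` enum K]); last first.
    by apply/seteqP; split => q; rewrite /= mem_enum.
  rewrite -fsbig_seq ?enum_uniq// big_enum sumEFin sumr_const lee_fin.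
  by rewrite -mulrnAr ler_wpM2l.
have mufin : lebesgue_outer (mulmx M @` box ab) \is a fin_num.
  rewrite ge0_fin_numE ?lebesgue_outer_ge0//.
  by apply: le_lt_trans (bound 1 _) _ => //; rewrite ltry.
rewrite -(fineK mufin) lee_fin leNgt; apply/negP => lt_mu.
have : P h @[h --> 0] --> k * box_volume ab.
  rewrite [X in _ --> k * X](_ : _ = \prod_(i < d) (ab.2 i 0 - ab.1 i 0)).
    by apply: cvgMr; exact: prod_shift_cvg.
  by apply: eq_bigr => i _; rewrite max_r// subr_ge0 ltW.
move=> /cvgr_lt /(_ _ lt_mu) /nbhs_ballP[e /= e0 eP].
have /= := eP (e / 2); rewrite /ball/= sub0r normrN gtr0_norm ?divr_gt0// => /(_ _) Pe.
have := bound (e / 2); rewrite divr_gt0// => /(_ isT).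
by rewrite -(fineK mufin) lee_fin leNgt Pe// ltr_pdivrMr// ltr_pMr// ltr1n.
Qed.

End linear_images.

Section measurability.
Context (R : realType) (d : nat).
Implicit Types (X : set 'cV[R]_d) (ab : 'cV[R]_d * 'cV[R]_d).

Lemma measurable_coord_le (i : 'I_d) (t : R) :
  measurable ([set x | x i 0 <= t] : set (lebesgue_space R d)).
Proof.
apply: le_caratheodory_measurable => X; set H := [set x | _].
pose l ab : 'cV[R]_d * 'cV[R]_d :=
  (ab.1, \col_j if j == i then Num.min (ab.2 i 0) t else ab.2 j 0).
pose r ab : 'cV[R]_d * 'cV[R]_d :=
  (\col_j if j == i then Num.max (ab.1 i 0) t else ab.1 j 0, ab.2).
have volD ab : ((box_volume (l ab))%:E + (box_volume (r ab))%:E =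
    (box_volume ab)%:E)%E.
  have volE (x y : R) (f : 'cV[R]_d * 'cV[R]_d) : f.2 i 0 = y -> f.1 i 0 = x ->
      (forall j, j != i -> f.2 j 0 - f.1 j 0 = ab.2 j 0 - ab.1 j 0) ->
      box_volume f = Num.max 0 (y - x) *
        \prod_(j < d | j != i) Num.max 0 (ab.2 j 0 - ab.1 j 0).
    move=> <- <- fj; rewrite /box_volume (bigD1 i)//=; congr (_ * _).
    by apply: eq_bigr => j ji; rewrite fj.
  rewrite -EFinD; congr EFin.
  rewrite (volE (ab.1 i 0) (Num.min (ab.2 i 0) t)); last 3 first.
  - by rewrite mxE eqxx.
  - by [].
  - by move=> j /negbTE ji; rewrite mxE ji.
  rewrite (volE (Num.max (ab.1 i 0) t) (ab.2 i 0)); last 3 first.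
  - by [].
  - by rewrite mxE eqxx.
  - by move=> j /negbTE ji; rewrite mxE ji.
  rewrite (volE (ab.1 i 0) (ab.2 i 0))// -mulrDl; congr (_ * _).
  have [?|?] := leP (ab.2 i 0) t; have [?|?] := leP (ab.1 i 0) t;
    by rewrite /Num.max; repeat case: ltP => ?; lra.
apply: le_ereal_inf_tmp => _ [B [cB XB] <-].
have -> : \esum_(ab in B) (box_volume ab)%:E =
    (\esum_(ab in B) (box_volume (l ab))%:E + \esum_(ab in B) (box_volume (r ab))%:E)%E.
  rewrite -esumD; [|by move=> ab _; exact: box_volume_ge0..].
  by apply: eq_esum => ab _; rewrite volD.
have cover (Y : set 'cV[R]_d) (f : 'cV[R]_d * 'cV[R]_d -> 'cV[R]_d * 'cV[R]_d) :
    (forall ab, box ab `&` Y `<=` box (f ab)) ->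
    (lebesgue_outer (X `&` Y) <= \esum_(ab in B) (box_volume (f ab))%:E)%E.
  move=> fY; apply: (@le_trans _ _ (lebesgue_outer (\bigcup_(ab in B) box (f ab)))).
    apply: le_lebesgue_outer => x [/XB[ab Bab abx] Yx].
    by exists ab => //; apply: fY.
  apply: le_trans (outer_measure_bigcup_le_esum _ _ cB) _.
  by apply: le_esum => ab _; exact: lebesgue_outer_box.
apply: leeD; apply: cover => ab x [abx].
  move=> Hx j; have /andP[ax xb] := abx j; rewrite !mxE ax/=.
  by case: eqP => // ->; rewrite le_min Hx andbT; have /andP[] := abx i.
rewrite /H/= => /negP; rewrite -ltNge => Hx j; have /andP[ax xb] := abx j.
rewrite /r/= !mxE xb andbT.
by case: eqP => // ->; rewrite gt_max Hx andbT; have /andP[] := abx i.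
Qed.

Lemma measurable_box ab : measurable (box ab : set (lebesgue_space R d)).
Proof.
have -> : box ab = \bigcap_(i in [set: 'I_d])
    ([set x : lebesgue_space R d | x i 0 <= ab.2 i 0] `\` [set x | x i 0 <= ab.1 i 0]).
  apply/seteqP; split => x abx i; last first.
    by have [/= -> /negP] := abx i I; rewrite -ltNge => ->.
  by move=> _; have /andP[ax xb] := abx i; split => //=; apply/negP; rewrite -ltNge.
apply: fin_bigcap_measurable; first exact: finite_finset.
by move=> i _; apply: measurableD; exact: measurable_coord_le.
Qed.

Lemma open_measurable_lebesgue X : open X -> measurable (X : set (lebesgue_space R d)).
Proof.
move=> oX; pose g (p : nat * {ffun 'I_d -> int}) : 'cV[R]_d * 'cV[R]_d :=
  (\col_i ((p.2 i - 1)%:~R / p.1.+1%:R), \col_i ((p.2 i)%:~R / p.1.+1%:R)).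
pose F p := if `[< box (g p) `<=` X >] then box (g p) else set0.
rewrite (_ : X = \bigcup_p F p); last first.
  apply/seteqP; split => [x Xx|x [p _]]; last by rewrite /F; case: asboolP => // pX /pX.
  have := open_nbhs_nbhs (conj oX Xx); rewrite nbhs_ballP => -[e /= e0 eX].
  pose n := Num.trunc (e^-1).
  have n0 : 0 < n.+1%:R :> R by rewrite ltr0n.
  have ne : n.+1%:R^-1 < e.
    by rewrite invf_plt ?posrE// truncnS_gt.
  pose p := (n, [ffun i => Num.ceil (x i 0 * n.+1%:R)]).
  have xp : box (g p) x.
    move=> i; rewrite !mxE !ffunE ltr_pdivrMr// ler_pdivlMr//.
    exact: ceil_itv.
  exists p => //; rewrite /F asboolT// => y yp.
  apply: eX; split => // i j; rewrite ord1 {j}.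
  have near_e (c z a b : R) : z < e ->
      c - z < a <= c -> c - z < b <= c -> `|a - b| < e.
    by move=> ze /andP[? ?] /andP[? ?]; rewrite ltr_norml; apply/andP; split; lra.
  apply: (near_e ((p.2 i)%:~R / n.+1%:R) _ _ _ ne); [move: (xp i)|move: (yp i)];
    by rewrite !mxE intrB mulrBl mul1r.
apply: countable_bigcupT_measurable => // p; rewrite /F; case: ifPn => // _.
exact: measurable_box.
Qed.

End measurability.

Section orthogonal_invariance.
Context (R : realType) (d : nat).
Implicit Types (X : set 'cV[R]_d) (M Q : 'M[R]_d).

Definition euclidean_ball : set 'cV[R]_d := [set x | \sum_(i < d) x i 0 ^+ 2 < 1].

Lemma open_euclidean_ball : open euclidean_ball.
Proof.
have cont : continuous (fun x : 'cV[R]_d => \sum_(i < d) x i 0 ^+ 2).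
  apply: continuous_big => [|i _ x]; first exact: add_continuous.
  apply: (@continuous_comp _ _ _ (fun x : 'cV[R]_d => x i 0) (fun y => y ^+ 2)).
    exact: coord_continuous.
  exact: exprn_continuous.
by apply: (open_comp (f := fun x : 'cV[R]_d => \sum_(i < d) x i 0 ^+ 2)
  (D := [set y | y < 1])) => [x _|]; [exact: cont|exact: open_lt].
Qed.

Lemma sub_euclidean_ball_cube : euclidean_ball `<=` @centered_cube R d.
Proof.
move=> x xE i; rewrite !mxE.
have : x i 0 ^+ 2 < 1.
  by apply: le_lt_trans xE; rewrite (bigD1 i)//= lerDl sumr_ge0// => j _; rewrite sqr_ge0.
by move=> ?; apply/andP; split; nra.
Qed.

Lemma mulmx_euclidean_ball Q : Q^T *m Q = 1%:M ->
  mulmx Q @` euclidean_ball `<=` euclidean_ball.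
Proof.
have sqE (x : 'cV[R]_d) : \sum_(i < d) x i 0 ^+ 2 = (x^T *m x) 0 0.
  by rewrite mxE; apply: eq_bigr => i _; rewrite mxE expr2.
move=> QQ _ [x + <-]; rewrite /euclidean_ball/= !sqE.
by rewrite trmx_mul mulmxA -(mulmxA x^T) QQ mulmx1.
Qed.

Lemma lebesgue_outer_mulmx_cube_fin M :
  lebesgue_outer (mulmx M @` @centered_cube R d) \is a fin_num.
Proof.
rewrite ge0_fin_numE ?lebesgue_outer_ge0//.
pose K := 1 + \sum_i \sum_j `|M i j|.
have KP (x : 'cV[R]_d) : @centered_cube R d x -> forall i, `|(M *m x) i 0| < K.
  move=> Cx i; rewrite mxE /K ltr_pwDl// [leRHS](bigD1 i)//= -[leLHS]addr0 lerD//.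
    rewrite (le_trans (ler_norm_sum _ _ _))// ler_sum// => j _.
    have := Cx j; rewrite !mxE normrM => /andP[x1 x2].
    by rewrite ler_piMr// ler_norml x2 ltW.
  by rewrite sumr_ge0// => j _; rewrite sumr_ge0.
apply: le_lt_trans
  (ltry (box_volume (const_mx (- K) : 'cV[R]_d, const_mx K))).
apply: le_trans (lebesgue_outer_box _).
apply: le_lebesgue_outer => _ [x /KP xK <-] i; have := xK i.
by rewrite !mxE ltr_norml => /andP[-> /ltW].
Qed.

Lemma lebesgue_outer_mulmx_le Q X : Q^T *m Q = 1%:M ->
  (lebesgue_outer (mulmx Q @` X) <= lebesgue_outer X)%E.
Proof.
move=> QQ; rewrite -[leRHS]mul1e; apply: lebesgue_outer_image => // ab {X}.
set C := @centered_cube R d; set E := euclidean_ball.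
have muC : (lebesgue_outer C <= (2 ^+ d)%:E)%E.
  by rewrite -box_volume_centered_cube; exact: lebesgue_outer_box.
have [E0|En0] := eqVneq (lebesgue_outer E) 0%E.
  (* Dilates of [E] cover the space, so [mu] would vanish: no lower bound on the
     measure of boxes is needed. *)
  rewrite mul1r (le_trans _ (box_volume_ge0 _))//.
  apply: (@le_trans _ _ (lebesgue_outer [set: 'cV[R]_d])); first exact: le_lebesgue_outer.
  have -> : [set: 'cV[R]_d] = \bigcup_n [set n.+1%:R *: x + 0 | x in E].
    apply/seteqP; split => // x _; pose s := \sum_i x i 0 ^+ 2.
    have s0 : 0 <= s by apply: sumr_ge0 => i _; rewrite sqr_ge0.
    exists (Num.trunc s) => //; set n := (Num.trunc s).+1%:R : R.
    have n1 : 1 <= n by rewrite ler1n.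
    have sn : s < n by exact: truncnS_gt.
    have n0 : 0 < n by exact: lt_le_trans n1.
    exists (n^-1 *: x); last by rewrite addr0 scalerA mulfV ?gt_eqF// scale1r.
    rewrite /E/euclidean_ball/= (eq_bigr (fun i => n^-1 ^+ 2 * x i 0 ^+ 2)); last first.
      by move=> i _; rewrite mxE exprMn.
    rewrite -mulr_sumr -/s exprVn ltr_pdivrMl ?exprn_gt0// mulr1.
    by rewrite (lt_le_trans sn)// expr2 ler_peMl// ltW.
  apply: le_trans (outer_measure_sigma_subadditive _ _) _.
  rewrite eseries0// => n _ _; apply/eqP; rewrite eq_le outer_measure_ge0 andbT.
  by apply: le_trans (lebesgue_outer_affine _ _ _) _; rewrite ?E0 ?mule0.
have Cfin := lebesgue_outer_mulmx_cube_fin Q.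
pose c := fine (lebesgue_outer (mulmx Q @` C)) / 2 ^+ d.
have d0 : 0 < 2 ^+ d :> R by rewrite exprn_gt0.
have cE : lebesgue_outer (mulmx Q @` C) = (c * 2 ^+ d)%:E.
  by rewrite /c divfK ?gt_eqF// fineK.
suff c1 : c <= 1 by apply: lebesgue_outer_mulmx_box; rewrite cE lee_fin ler_pM2r.
have [c0|c0] := leP c 0; first exact: le_trans c0 ler01.
have Qc Y : (lebesgue_outer (mulmx Q @` Y) <= c%:E * lebesgue_outer Y)%E.
  apply: lebesgue_outer_image => // ab'.
  by apply: lebesgue_outer_mulmx_box; rewrite cE.
have EC : C `&` E = E by apply: setIidr; exact: sub_euclidean_ball_cube.
have mE := @open_measurable_lebesgue R d _ open_euclidean_ball.
have CE : lebesgue_outer C = (lebesgue_outer E + lebesgue_outer (C `&` ~` E))%E.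
  by have := mE C; rewrite EC.
have Cf : lebesgue_outer C \is a fin_num.
  by rewrite ge0_fin_numE ?lebesgue_outer_ge0// (le_lt_trans muC)// ltry.
have Ef : lebesgue_outer E \is a fin_num.
  rewrite ge0_fin_numE ?lebesgue_outer_ge0//.
  apply: le_lt_trans (_ : lebesgue_outer C < +oo)%E.
    2: by rewrite -ge0_fin_numE ?lebesgue_outer_ge0.
  exact/le_lebesgue_outer/sub_euclidean_ball_cube.
have Df : lebesgue_outer (C `&` ~` E) \is a fin_num.
  rewrite ge0_fin_numE ?lebesgue_outer_ge0//.
  apply: le_lt_trans (_ : lebesgue_outer C < +oo)%E.
    2: by rewrite -ge0_fin_numE ?lebesgue_outer_ge0.
  by apply/le_lebesgue_outer => x [].
have QC : (lebesgue_outer (mulmx Q @` C) <=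
    lebesgue_outer E + c%:E * lebesgue_outer (C `&` ~` E))%E.
  apply: (@le_trans _ _ (lebesgue_outer (mulmx Q @` E) +
      lebesgue_outer (mulmx Q @` (C `&` ~` E)))%E).
    apply: le_trans (outer_measureU2 _ _ _).
    apply: le_lebesgue_outer => _ [x Cx <-].
    by have [Ex|nEx] := pselect (E x); [left|right]; exists x.
  by apply: leeD => //; apply/le_lebesgue_outer/mulmx_euclidean_ball.
have E0 : 0 < fine (lebesgue_outer E).
  rewrite lt_neqAle fine_ge0 ?lebesgue_outer_ge0// andbT eq_sym.
  by apply: contra En0 => /eqP e0; rewrite -(fineK Ef) e0.
(* With [e = mu E], [D = mu (C \ E)] and [V = 2 ^ d >= mu C]: as [Q E = E], one
   has [c * V = mu (Q C) <= mu (Q E) + mu (Q (C \ E)) <= e + c * D]. *)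
have slack (e D V : R) : 0 < e -> c * V <= e + c * D -> e + D <= V -> c <= 1.
  move=> e0 cV eDV; have ceD : c * (e + D) <= c * V by rewrite ler_wpM2l// ltW.
  by rewrite -(ler_pM2r e0) mul1r; lra.
move: QC muC; rewrite CE cE -(fineK Ef) -(fineK Df) -!EFinM -!EFinD !lee_fin.
exact: slack.
Qed.

Lemma lebesgue_outer_mulmx Q X : Q *m Q^T = 1%:M ->
  lebesgue_outer (mulmx Q @` X) = lebesgue_outer X.
Proof.
move=> QQ; have QQ' := mulmx1C QQ.
apply/eqP; rewrite eq_le lebesgue_outer_mulmx_le//=.
have := @lebesgue_outer_mulmx_le Q^T (mulmx Q @` X); rewrite trmxK => /(_ QQ).
apply: le_trans; apply: le_lebesgue_outer => x Xx.
by exists (Q *m x); [exists x|rewrite mulmxA QQ' mul1mx].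
Qed.

End orthogonal_invariance.

(** * Change of variables *)

Section integral_change_of_variables.
Local Open Scope ereal_scope.
Context dsp (T : measurableType dsp) (R : realType) (mu : {measure set T -> \bar R}).

Import HBNNSimple.

Lemma nnsfun_comp (phi : T -> T) (h : {nnsfun T >-> R}) :
  measurable_fun setT phi ->
  exists g : {nnsfun T >-> R}, (g : T -> R) = h \o phi.
Proof.
move=> mphi; pose g := h \o phi.
have mg : measurable_fun setT g by apply: measurableT_comp.
have fg : finite_set (range g).
  by apply: sub_finite_set (fimfunP h) => _ [x _ <-]; exists (phi x).
have ng x : (0 <= g x)%R by exact: fun_ge0.
pose M := isMeasurableFun.Build _ _ _ _ g mg.
pose F := FiniteImage.Build _ _ g fg.
pose N := isNonNegFun.Build _ _ g ng.
pose G : {nnsfun T >-> R} := HB.pack g M F N.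
by exists G.
Qed.

Lemma sintegral_comp_sub (phi psi : T -> T) (f : T -> \bar R) :
  cancel psi phi -> measurable_fun setT phi ->
  (forall A, measurable A -> mu (phi @^-1` A) = mu A) ->
  [set sintegral mu h | h in [set h : {nnsfun T >-> R} | forall x, (h x)%:E <= f x]]
  `<=`
  [set sintegral mu h |
    h in [set h : {nnsfun T >-> R} | forall x, (h x)%:E <= f (phi x)]].
Proof.
move=> psiK mphi muphi _ [h /= hf <-].
have [g gE] := nnsfun_comp h mphi; exists g; first by move=> /= x; rewrite gE; exact: hf.
apply: eq_fsbigr => r _; congr (_ * _).
by rewrite gE comp_preimage muphi.
Qed.

(* [f] need not be measurable: the integral is a supremum over simple functions,
   which [phi] puts in bijection. *)
Lemma integral_comp_bij (phi psi : T -> T) (D : set T) (f : T -> \bar R) :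
  cancel phi psi -> cancel psi phi ->
  measurable_fun setT phi -> measurable_fun setT psi ->
  (forall A, measurable A -> mu (phi @^-1` A) = mu A) ->
  \int[mu]_(x in phi @^-1` D) f (phi x) = \int[mu]_(x in D) f x.
Proof.
move=> phiK psiK mphi mpsi muphi.
have mupsi A : measurable A -> mu (psi @^-1` A) = mu A.
  move=> mA; rewrite -muphi.
    by rewrite -comp_preimage; congr (mu _); apply/seteqP; split => x; rewrite /= phiK.
  by rewrite -[X in measurable X]setTI; exact: mpsi.
have nnE (g : T -> \bar R) :
    [set sintegral mu h | h in
      [set h : {nnsfun T >-> R} | forall x, (h x)%:E <= g (phi x)]] =
    [set sintegral mu h | h in [set h : {nnsfun T >-> R} | forall x, (h x)%:E <= g x]].
  apply/seteqP; split; last exact: (@sintegral_comp_sub phi psi).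
  move=> _ /(sintegral_comp_sub phiK mpsi mupsi)[h /= hg <-].
  by exists h => //= x; have := hg x; rewrite psiK.
have restr : (fun x => f (phi x)) \_ (phi @^-1` D) = (f \_ D) \o phi.
  by apply/funext => x; rewrite /patch /=; congr (if _ then _ else _).
have posE : (f \_ D \o phi)^\+ = (f \_ D)^\+ \o phi.
  by apply/funext => x; rewrite /= !funeposE.
have negE : (f \_ D \o phi)^\- = (f \_ D)^\- \o phi.
  by apply/funext => x; rewrite /= !funenegE.
rewrite /integral restr posE negE.
by rewrite -(nnE ((f \_ D)^\+)) -(nnE ((f \_ D)^\-)).
Qed.

End integral_change_of_variables.

Section lebesgue_change_of_variables.
Context (R : realType) (d : nat).
Implicit Types (Q : 'M[R]_d).

Lemma image_mulmx Q (X : set 'cV[R]_d) : Q *m Q^T = 1%:M ->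
  mulmx Q @` X = mulmx Q^T @^-1` X.
Proof.
move=> QQ; have QQ' := mulmx1C QQ; apply/seteqP; split => [_ [x Xx <-]|x Xx].
  by rewrite /preimage/= mulmxA QQ' mul1mx.
by exists (Q^T *m x); rewrite // mulmxA QQ mul1mx.
Qed.

Lemma measurable_mulmx Q : Q *m Q^T = 1%:M ->
  measurable_fun setT (mulmx Q : lebesgue_space R d -> lebesgue_space R d).
Proof.
move=> QQ _ A mA; rewrite setTI.
have mA' : caratheodory_measurable (@lebesgue_outer R d) A := mA.
suff : caratheodory_measurable (@lebesgue_outer R d) (mulmx Q @^-1` A) by [].
move=> X.
have QQ' : Q^T *m Q^T^T = 1%:M by rewrite trmxK (mulmx1C QQ).
have preE (Y : set 'cV[R]_d) : lebesgue_outer (mulmx Q @^-1` Y) = lebesgue_outer Y.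
  by rewrite -[Q in mulmx Q @^-1` _]trmxK -image_mulmx// lebesgue_outer_mulmx.
have XE : X = mulmx Q @^-1` (mulmx Q @` X).
  by rewrite image_mulmx// -comp_preimage; apply/seteqP; split => x;
    rewrite /= mulmxA (mulmx1C QQ) mul1mx.
rewrite XE preimage_setC -!preimage_setI.
by rewrite !preE; exact: mA'.
Qed.

Lemma integral_mulmx Q (D : set 'cV[R]_d) (f : 'cV[R]_d -> \bar R) :
  Q *m Q^T = 1%:M ->
  (\int[lebesgue d]_(x in mulmx Q @^-1` D) f (Q *m x) = \int[lebesgue d]_(x in D) f x)%E.
Proof.
move=> QQ; have QQ' : Q^T *m Q^T^T = 1%:M by rewrite trmxK (mulmx1C QQ).
apply: (@integral_comp_bij _ (lebesgue_space R d) _ (lebesgue d)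
  (mulmx Q) (mulmx Q^T)).
- by move=> x; rewrite mulmxA (mulmx1C QQ) mul1mx.
- by move=> x; rewrite mulmxA QQ mul1mx.
- exact: measurable_mulmx.
- exact: measurable_mulmx.
- move=> A _; rewrite -[Q in mulmx Q @^-1` _]trmxK -image_mulmx//.
  exact: lebesgue_outer_mulmx.
Qed.

End lebesgue_change_of_variables.

(** * Directional derivatives of C^1 fields *)

Section directional_derivatives.
Context {R : realType}.
Implicit Types (W U : normedModType R).

Lemma lipschitz_linear_continuous U U' (L : U -> U') (M : R) :
  linear L -> (forall x, `|L x| <= M * `|x|) -> continuous L.
Proof.
move=> linL LM.
pose L' : {linear U -> U'} := HB.pack L (GRing.isLinear.Build _ _ _ _ L linL).
suff : continuous (L' : U -> U') by [].
apply/linear_bounded_continuous/linear_boundedP; near=> r => x.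
apply: le_trans (LM x) _; rewrite ler_wpM2r//; near: r.
Unshelve. all: by end_near. Qed.

Lemma is_derive_linear W U U' (L : U -> U') (f : W -> U) x v :
  linear L -> continuous L -> derivable f x v ->
  is_derive x v (L \o f) (L ('D_v f x)).
Proof.
move=> linL cL fxv.
pose L' : {linear U -> U'} := HB.pack L (GRing.isLinear.Build _ _ _ _ L linL).
have quotE : (fun h => h^-1 *: (((L \o f) \o shift x) (h *: v) - (L \o f) x)) =
    L \o (fun h => h^-1 *: ((f \o shift x) (h *: v) - f x)).
  apply/funext => h /=.
  by rewrite -(linearB L') -(linearZ_LR L').
have cvgL : (fun h => h^-1 *: (((L \o f) \o shift x) (h *: v) - (L \o f) x)) @ 0^' -->
    L ('D_v f x).
  by rewrite quotE; apply: continuous_cvg; [exact: cL|exact: fxv].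
by apply: DeriveDef; [apply/cvg_ex; exists (L ('D_v f x))|exact/cvg_lim].
Qed.

Lemma is_derive_line W U (f : W -> U) (z v : W) (t : R) :
  derivable f (t *: v + z) v ->
  is_derive (t : R^o) (1 : R^o) (fun s : R^o => f (s *: v + z)) ('D_v f (t *: v + z)).
Proof.
move=> ftv.
have quotE : (fun h : R => h^-1 *:
    (((fun s : R^o => f (s *: v + z)) \o shift (t : R^o)) (h *: (1 : R^o)) -
    f (t *: v + z))) =
    (fun h : R => h^-1 *: ((f \o shift (t *: v + z)) (h *: v) - f (t *: v + z))).
  apply/funext => h /=; congr (_ *: (f _ - _)).
  by rewrite -[h *: (1 : R^o)]/(h * 1) mulr1 scalerDl addrA.
by apply: DeriveDef; rewrite /derivable /derive quotE.
Qed.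

End directional_derivatives.

Section dual_pow_derivatives.
Context {R : realType} (V : normedModType R) (d : nat) (W : normedModType R).
Implicit Types (f : W -> dual_pow V d) (q : dual_pow V d).

Definition dual_pow_eval (i : 'I_d) (w : V) : dual_pow V d -> R^o := fun q => q i w.

Lemma linear_dual_pow_eval i w : linear (dual_pow_eval i w).
Proof. by []. Qed.

Lemma continuous_dual_pow_eval i w : `|w| <= 1 -> continuous (dual_pow_eval i w).
Proof.
move=> w1; apply: (@lipschitz_linear_continuous _ _ _ _ 1 (linear_dual_pow_eval i w)) => q.
by rewrite mul1r (le_trans (dual_norm_ub (q i) w1))// dual_pow_norm_ub.
Qed.

Lemma dual_pow_norm_eval q (M : R) : 0 <= M ->
  (forall i w, `|w| <= 1 -> `|dual_pow_eval i w q| <= M) -> `|q| <= M.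
Proof.
move=> M0 qM; apply: (iffRL (dual_pow_norm_le _ M0)) => i.
by apply: dual_norm_le => w w1; exact: qM.
Qed.

End dual_pow_derivatives.

Section mean_value.
Context {R : realType} (V : normedModType R) (d : nat) (W : normedModType R).
Implicit Types (f : W -> dual_pow V d) (q : dual_pow V d) (x v w z : W).

Lemma mean_value_dual_pow f z v q (s e : R) : 0 <= s -> 0 <= e ->
  (forall t, 0 <= t <= s -> derivable f (t *: v + z) v /\
    `|'D_v f (t *: v + z) - q| <= e) ->
  `|f (s *: v + z) - f z - s *: q| <= e * s.
Proof.
move=> s0 e0 fP; apply: dual_pow_norm_eval => [|i y y1]; first exact: mulr_ge0.
set L := dual_pow_eval i y.
have linL : linear L := linear_dual_pow_eval i y.
have cL : continuous L := @continuous_dual_pow_eval _ _ _ i y y1.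
pose g (t : R^o) : R^o := L (f (t *: v + z)) - L q * t.
pose dg (t : R^o) : R^o := L ('D_v f (t *: v + z)) - L q.
have gd (t : R) : 0 <= t <= s -> is_derive (t : R^o) (1 : R^o) g (dg t).
  move=> /fP[ft _]; have fl := is_derive_line ft.
  have Lf : is_derive (t : R^o) (1 : R^o) (fun s : R^o => L (f (s *: v + z)))
      (L ('D_v f (t *: v + z))).
    have := is_derive_linear linL cL (@ex_derive _ _ _ _ _ _ _ fl).
    by rewrite (@derive_val _ _ _ _ _ _ _ fl).
  have Lq : is_derive (t : R^o) (1 : R^o) (L q \*: (id : R^o -> R^o)) (L q).
    by rewrite -[X in is_derive _ _ _ X](mulr1 (L q)); exact: is_deriveZ.
  exact: is_deriveB.
have [c cs gc] : exists2 c, c \in `[0, s] & g s - g 0 = dg c * (s - 0).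
  apply: MVT_segment => //.
    by move=> t; rewrite in_itv/= => /andP[t0 ts]; apply: gd; rewrite !ltW.
  apply: derivable_within_continuous => t; rewrite in_itv/= => ts.
  exact: (@ex_derive _ _ _ _ _ _ _ (gd t ts)).
have -> : L (f (s *: v + z) - f z - s *: q) = g s - g 0.
  rewrite /g scale0r add0r mulr0 subr0 addrAC.
  by rewrite (mulrC (L q)).
rewrite gc subr0 normrM (ger0_norm s0) ler_wpM2r//.
have [_ /(le_trans _)] := fP c cs; apply.
rewrite -[dg c]/(('D_v f (c *: v + z) - q) i y).
by rewrite (le_trans (dual_norm_ub _ y1))// dual_pow_norm_ub.
Qed.

Lemma mean_value_dual_pow_normr f z v q (s e : R) : 0 <= e ->
  (forall t, `|t| <= `|s| -> derivable f (t *: v + z) v /\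
    `|'D_v f (t *: v + z) - q| <= e) ->
  `|f (s *: v + z) - f z - s *: q| <= e * `|s|.
Proof.
move=> e0 fP; have [s0|s0] := leP 0 s.
  rewrite ger0_norm//; apply: mean_value_dual_pow => // t /andP[t0 ts].
  by apply: fP; rewrite !ger0_norm.
have := @mean_value_dual_pow f (s *: v + z) v q (- s) e.
rewrite oppr_ge0 (ltW s0) => /(_ isT e0) mv.
have -> : f (s *: v + z) - f z - s *: q =
    - (f (- s *: v + (s *: v + z)) - f (s *: v + z) - (- s) *: q).
  by rewrite addrA -scalerDl addNr scale0r add0r scaleNr opprK opprD opprB.
rewrite normrN ltr0_norm//; apply: mv => t /andP[t0 ts].
rewrite addrA -scalerDl; apply: fP.
by rewrite (ltr0_norm s0) ler_norml opprK; apply/andP; split; lra.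
Qed.

Lemma is_derive_add_direction f x v w (a : R) :
  (\forall y \near x, derivable f y v) -> {for x, continuous ('D_v f)} ->
  derivable f x w ->
  is_derive x (w + a *: v) f ('D_w f x + a *: 'D_v f x).
Proof.
move=> fv cv fw.
pose q1 (h : R) := h^-1 *: (f ((h * a) *: v + (h *: w + x)) - f (h *: w + x)).
pose q2 (h : R) := h^-1 *: ((f \o shift x) (h *: w) - f x).
have quotE : (fun h => h^-1 *: ((f \o shift x) (h *: (w + a *: v)) - f x)) =
    (fun h => q2 h + q1 h).
  apply/funext => h /=; rewrite -scalerDr; congr (_ *: _).
  rewrite /= scalerDr scalerA (addrC (h *: w)) -addrA.
  by rewrite [RHS]addrC [RHS]addrA subrK.
have cq1 : q1 @ 0^' --> a *: 'D_v f x.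
  apply/cvgrPdist_le => e e0.
  pose e' := e / (`|a| + 1).
  have a1 : 0 < `|a| + 1 by rewrite ltr_wpDl.
  have e'0 : 0 < e' by rewrite divr_gt0.
  have cvx : \forall y \near x, `|'D_v f y - 'D_v f x| <= e'.
    by move/cvgrPdistC_le : cv => /(_ e' e'0).
  have [r /= r0 rP] := iffLR (nbhs_normP x _) (filterI fv cvx).
  have N0 : 0 < `|w| + `|a| * `|v| + 1.
    by rewrite ltr_wpDl// addr_ge0// mulr_ge0.
  near=> h.
  have hr : `|h| * (`|w| + `|a| * `|v|) < r.
    apply: (@le_lt_trans _ _ (`|h| * (`|w| + `|a| * `|v| + 1))).
      by rewrite ler_wpM2l// lerDl.
    rewrite -ltr_pdivlMr//; near: h; apply: dnbhs0_lt.
    exact: divr_gt0.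
  have h0 : h != 0 by near: h; exact: nbhs_dnbhs_neq.
  have -> : a *: 'D_v f x - q1 h = - (h^-1 *: (f ((h * a) *: v + (h *: w + x)) -
      f (h *: w + x) - (h * a) *: 'D_v f x)).
    by rewrite scalerBr scalerA mulKf// opprB.
  rewrite normrN normrZ normfV ler_pdivrMl ?normr_gt0//.
  apply: (@le_trans _ _ (e' * `|h * a|)).
    apply: mean_value_dual_pow_normr => [|t th]; first exact: ltW.
    rewrite addrA; apply: rP; rewrite /= opprD addrCA subrr addr0 normrN.
    apply: le_lt_trans hr.
    rewrite mulrDr addrC; apply: le_trans (ler_normD _ _) _.
    by rewrite !normrZ lerD// mulrA -normrM ler_wpM2r.
  rewrite normrM mulrCA ler_wpM2l// /e' mulrAC ler_pdivrMr// ler_wpM2l ?ltW//.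
  by rewrite ltrDl.
have cq : (fun h => q2 h + q1 h) @ 0^' --> 'D_w f x + a *: 'D_v f x.
  by apply: cvgD => //; exact: fw.
apply: DeriveDef; rewrite /derivable /derive quotE.
  by apply/cvg_ex; eexists; exact: cq.
exact: cvg_lim.
Unshelve. all: by end_near. Qed.


End mean_value.

Section directional_derivative.
Context {R : realType} (V : normedModType R) (d : nat).
Implicit Types (f : 'cV[R]_d -> dual_pow V d) (x v : 'cV[R]_d).

Lemma is_derive_C1 (Omega : set 'cV[R]_d) f x v :
  open Omega -> Omega x ->
  (forall i, (forall y, Omega y -> derivable f y (std_basis i)) /\
    {for x, continuous ('D_(std_basis i) f)}) ->
  is_derive x v f (\sum_(i < d) v i 0 *: 'D_(std_basis i) f x).
Proof.
move=> oO Ox fC1; have -> : v = \sum_(i < d) v i 0 *: (std_basis i : 'cV[R]_d).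
  rewrite {1}[v]matrix_sum_delta; apply: eq_bigr => i _.
  by rewrite big_ord1.
have -> : \sum_(i < d) (\sum_(j < d) v j 0 *: (std_basis j : 'cV[R]_d)) i 0 *:
      'D_(std_basis i : 'cV[R]_d) f x =
    \sum_(i < d) v i 0 *: 'D_(std_basis i : 'cV[R]_d) f x.
  apply: eq_bigr => i _; congr (_ *: _).
  rewrite summxE (bigD1 i)//= !mxE eqxx mulr1 big1 ?addr0// => j ji.
  by rewrite !mxE eq_sym (negbTE ji) mulr0.
elim: (index_enum _) => [|i s IH].
  by rewrite !big_nil; exact: is_derive0.
rewrite !big_cons ![v i 0 *: _ + _]addrC.
have [fd fc] := fC1 i.
have := @is_derive_add_direction _ _ _ _ f x (std_basis i) _ (v i 0) _ fc
  (@ex_derive _ _ _ _ _ _ _ IH).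
rewrite (@derive_val _ _ _ _ _ _ _ IH); apply.
by apply: filterS (open_nbhs_nbhs (conj oO Ox)) => y; exact: fd.
Qed.

End directional_derivative.

(** * Rotated test fields *)

Section rotated_field.
Context {R : realType} (V : normedModType R) (d : nat).
Implicit Types (Omega : set 'cV[R]_d) (p : 'cV[R]_d -> dual_pow V d) (Q : 'M[R]_d)
  (x y v : 'cV[R]_d).

Lemma mulmx_continuous Q : continuous (mulmx Q : 'cV[R]_d -> 'cV[R]_d).
Proof.
apply: (@lipschitz_linear_continuous _ _ _ _ (\sum_i \sum_j `|Q i j|)).
  by move=> a x y; rewrite mulmxDr -scalemxAr.
move=> x; rewrite [leLHS]/Num.norm/= mx_normrE.
have S0 : 0 <= \sum_i \sum_j `|Q i j|.
  by apply: sumr_ge0 => i _; exact: sumr_ge0.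
apply: bigmax_le => [|[i k] _ /=]; first by rewrite mulr_ge0.
rewrite mxE (le_trans (ler_norm_sum _ _ _))// mulr_suml [leRHS](bigD1 i)//=.
rewrite -[leLHS]addr0 lerD//; last first.
  by apply: sumr_ge0 => i' _; rewrite mulr_ge0// sumr_ge0.
rewrite mulr_suml ler_sum// => j _; rewrite normrM ler_wpM2l//.
rewrite [leRHS]/Num.norm/= mx_normrE.
by rewrite (le_bigmax _ (fun ij => `|x ij.1 ij.2|) (j, k)).
Qed.

Lemma rot_dual_linear Q : linear (@rot_dual R d V Q).
Proof.
move=> a q r; apply/funext => i; rewrite /rot_dual.
transitivity (\sum_(j < d) (a *: (Q i j *: q j) + Q i j *: r j)).
  by apply: eq_bigr => j _; rewrite scalerA (mulrC a) -scalerA -scalerDr.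
by rewrite big_split/= -scaler_sumr.
Qed.

Lemma rot_dual_continuous Q : continuous (@rot_dual R d V Q).
Proof.
apply: (@lipschitz_linear_continuous _ _ _ _ (\sum_i \sum_j `|Q i j|)).
  exact: rot_dual_linear.
move=> q; have S0 : 0 <= \sum_i \sum_j `|Q i j|.
  by apply: sumr_ge0 => i _; exact: sumr_ge0.
apply: (iffRL (dual_pow_norm_le _ _)) => [|i]; first by rewrite mulr_ge0.
rewrite (le_trans (ler_norm_sum _ _ _))// mulr_suml [leRHS](bigD1 i)//=.
rewrite -[leLHS]addr0 lerD//; last first.
  by apply: sumr_ge0 => i' _; rewrite mulr_ge0// sumr_ge0.
rewrite mulr_suml ler_sum// => j _; rewrite normrZ ler_wpM2l//.
exact: dual_pow_norm_ub.
Qed.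

Definition rot_field Q p : 'cV[R]_d -> dual_pow V d :=
  fun y => rot_dual Q^T (p (Q *m y)).

Lemma is_derive_rot_field Q p y v : derivable p (Q *m y) (Q *m v) ->
  is_derive y v (rot_field Q p) (rot_dual Q^T ('D_(Q *m v) p (Q *m y))).
Proof.
move=> pd.
have quotE : (fun h => h^-1 *: (((fun z => p (Q *m z)) \o shift y) (h *: v) - p (Q *m y))) =
    (fun h => h^-1 *: ((p \o shift (Q *m y)) (h *: (Q *m v)) - p (Q *m y))).
  by apply/funext => h /=; rewrite mulmxDr scalemxAr.
have pQ : derivable (fun z => p (Q *m z)) y v by rewrite /derivable quotE.
have -> : 'D_(Q *m v) p (Q *m y) = 'D_v (fun z => p (Q *m z)) y.
  by rewrite /derive quotE.
apply: (is_derive_linear (L := rot_dual Q^T)) => //.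
- exact: rot_dual_linear.
- exact: rot_dual_continuous.
Qed.

Lemma compactly_supportedP (W : normedModType R) Omega (f : 'cV[R]_d -> W) :
  compactly_supported Omega f <->
  exists K, [/\ compact K, K `<=` Omega & forall x, Omega x -> f x != 0 -> K x].
Proof.
split=> [[cS SO]|[K [cK KO fK]]].
  by exists (closure (Omega `&` [set x | f x != 0])); split => // x Ox fx; apply: subset_closure.
have clK : closed K by apply: compact_closed => //; exact: norm_hausdorff.
have SK : closure (Omega `&` [set x | f x != 0]) `<=` K.
  by rewrite (closure_id K).1//; apply: closure_subset => x [Ox fx]; exact: fK.
split; last exact: subset_trans KO.
by apply: subclosed_compact cK SK; exact: closed_closure.
Qed.

Lemma compact_preimage_mulmx Q (K : set 'cV[R]_d) : Q *m Q^T = 1%:M ->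
  compact K -> compact (mulmx Q @^-1` K).
Proof.
move=> QQ cK; have -> : mulmx Q @^-1` K = mulmx Q^T @` K.
  by rewrite -[Q in LHS]trmxK image_mulmx ?trmxK// (mulmx1C QQ).
apply: continuous_compact => //.
by apply: continuous_subspaceT; exact: mulmx_continuous.
Qed.

Lemma is_derive_std_rot_field Omega Q p y i : open Omega -> C1c Omega p ->
  Omega (Q *m y) ->
  is_derive y (std_basis i) (rot_field Q p)
    (rot_dual Q^T (\sum_(j < d) Q j i *: 'D_(std_basis j) p (Q *m y))).
Proof.
move=> oO [_ pC] Oy.
have := @is_derive_C1 _ _ _ _ p (Q *m y) (Q *m std_basis i) oO Oy.
move=> /(_ _)[|pd pE].
  by move=> j; have [pd pc _] := pC j; split => //; exact: pc.
have := is_derive_rot_field pd; rewrite pE.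
have -> // : \sum_(j < d) (Q *m std_basis i) j 0 *: 'D_(std_basis j) p (Q *m y) =
  \sum_(j < d) Q j i *: 'D_(std_basis j) p (Q *m y).
apply: eq_bigr => j _; congr (_ *: _); rewrite mxE (bigD1 i)//= mxE !eqxx mulr1.
by rewrite big1 ?addr0// => k ki; rewrite mxE (negbTE ki) mulr0.
Qed.

Lemma C1c_rot_field Omega Q p : Q *m Q^T = 1%:M -> open Omega -> C1c Omega p ->
  C1c (mulmx Q @^-1` Omega) (rot_field Q p).
Proof.
move=> QQ oO pC; have [pS pD] := pC.
have linQ : rot_dual Q^T 0 = 0 :> dual_pow V d.
  apply/funext => i; rewrite /rot_dual big1// => j _.
  exact: scaler0.
split.
  have /compactly_supportedP[K [cK KO pK]] := pS.
  apply/compactly_supportedP; exists (mulmx Q @^-1` K); split.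
  - exact: compact_preimage_mulmx.
  - exact: preimage_subset.
  - move=> y Oy; apply: contraNP => nKy; apply/eqP; rewrite /rot_field.
    by have [->|/pK-/(_ Oy)//] := eqVneq (p (Q *m y)) 0.
move=> i; have DE y : Omega (Q *m y) -> _ := @is_derive_std_rot_field Omega Q p y i oO pC.
have DE' y : Omega (Q *m y) -> 'D_(std_basis i) (rot_field Q p) y =
    rot_dual Q^T (\sum_(j < d) Q j i *: 'D_(std_basis j) p (Q *m y)).
  by move=> Oy; exact: (@derive_val _ _ _ _ _ _ _ (DE y Oy)).
split=> [y Oy|y Oy|].
- exact: (@ex_derive _ _ _ _ _ _ _ (DE y Oy)).
- have cont : {for y, continuous (fun y =>
      rot_dual Q^T (\sum_(j < d) Q j i *: 'D_(std_basis j) p (Q *m y)))}.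
    apply: continuous_comp; last exact: rot_dual_continuous.
    apply: (cvg_big add_continuous (nbhs_filter y)) => j _.
    have cD : {for y, continuous (fun z => 'D_(std_basis j) p (Q *m z))}.
      apply: (@continuous_comp _ _ _ (mulmx Q) ('D_(std_basis j) p)).
        exact: mulmx_continuous.
      by have [_ + _] := pD j; apply.
    exact: (@continuousZl_tmp _ _ _ (fun z => 'D_(std_basis j) p (Q *m z)) (Q j i) y cD).
  rewrite /prop_for /continuous_at (DE' y Oy).
  apply: cvg_trans cont; apply: near_eq_cvg; first exact: nbhs_filter.
  have nO : nbhs (Q *m y) Omega by exact: open_nbhs_nbhs.
  have nQ : \forall z \near y, Omega (Q *m z) := @mulmx_continuous Q y _ nO.
  by apply: filterS nQ => z /= /DE' ->.
- pose S j := closure (Omega `&` [set x | 'D_(std_basis j) p x != 0]).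
  pose K := \big[setU/set0]_(j < d) S j.
  apply/compactly_supportedP; exists (mulmx Q @^-1` K); split.
  + apply: compact_preimage_mulmx => //; apply: bigsetU_compact => j _.
    by have [_ _ []] := pD j.
  + apply: preimage_subset; rewrite /K; elim/big_ind : _ => //.
      by move=> A B AO BO x [/AO|/BO].
    by move=> j _; have [_ _ []] := pD j.
  + move=> y Oy; apply: contraNP => nKy; apply/eqP; rewrite DE'//.
    rewrite big1 ?linQ// => j _.
    have [->|Dn] := eqVneq ('D_(std_basis j) p (Q *m y)) 0; first exact: scaler0.
    exfalso; apply: nKy; rewrite /K /preimage/= (bigD1 j)//=.
    by left; apply: subset_closure.
Qed.

Lemma divergenceE p x : (forall i, derivable p x (std_basis i)) ->
  divergence p x = \sum_(i < d) ('D_(std_basis i) p x) i.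
Proof.
move=> pd; apply: eq_bigr => i _.
pose L (q : dual_pow V d) : dual V := q i.
have linL : linear L by [].
have cL : continuous L.
  by apply: (@lipschitz_linear_continuous _ _ _ _ 1 linL) => q; rewrite mul1r dual_pow_norm_ub.
exact: (@derive_val _ _ _ _ _ _ _ (is_derive_linear linL cL (pd i))).
Qed.

Lemma divergence_rot_field Omega Q p y : Q *m Q^T = 1%:M -> open Omega ->
  C1c Omega p -> Omega (Q *m y) ->
  divergence (rot_field Q p) y = divergence p (Q *m y).
Proof.
move=> QQ oO pC Oy.
have DE i := @is_derive_std_rot_field Omega Q p y i oO pC Oy.
rewrite !divergenceE; last 2 first.
- by move=> i; have [_ /(_ i)[+ _ _]] := pC; exact.
- by move=> i; exact: (@ex_derive _ _ _ _ _ _ _ (DE i)).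
transitivity (\sum_(i < d) \sum_(k < d) \sum_(j < d)
    (Q k i * Q j i) *: ('D_(std_basis j) p (Q *m y)) k).
  apply: eq_bigr => i _; rewrite (@derive_val _ _ _ _ _ _ _ (DE i)).
  rewrite /rot_dual; apply: eq_bigr => k _; rewrite mxE.
  have -> : (\sum_(j < d) Q j i *: 'D_(std_basis j) p (Q *m y)) k =
      \sum_(j < d) Q j i *: ('D_(std_basis j) p (Q *m y)) k.
    by rewrite fct_sumE.
  by rewrite scaler_sumr; apply: eq_bigr => j _; rewrite scalerA.
rewrite exchange_big; apply: eq_bigr => k _ /=.
rewrite exchange_big (bigD1 k)//= [X in _ + X]big1 ?addr0.
  rewrite -scaler_suml.
  have := congr1 (fun A : 'M[R]_d => A k k) QQ; rewrite !mxE eqxx.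
  under eq_bigr do rewrite mxE.
  by move=> ->; rewrite scale1r.
move=> j jk; rewrite -scaler_suml.
have := congr1 (fun A : 'M[R]_d => A k j) QQ; rewrite !mxE eq_sym (negbTE jk).
under eq_bigr do rewrite mxE.
by move=> ->; rewrite scale0r.
Qed.

End rotated_field.

Lemma SO_tr (R : realType) (d : nat) (Q : 'M[R]_d) : SO Q -> SO Q^T.
Proof. by move=> [QQ dQ]; split; rewrite ?det_tr// trmxK (mulmx1C QQ). Qed.

Lemma le_TV_preimage_mulmx (R : realType) (d : nat) (V : normedModType R)
    (Omega : set 'cV[R]_d) (N : dual_pow V d -> R) (u : 'cV[R]_d -> V) (Q : 'M[R]_d) :
  open Omega -> SO Q ->
  (forall (p : dual_pow V d) (P : 'M[R]_d), SO P -> N p = N (rot_dual P p)) ->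
  (TV N Omega u <= TV N (mulmx Q @^-1` Omega) (fun x => u (Q *m x)))%E.
Proof.
move=> oO SOQ invN; have [QQ _] := SOQ.
apply: ge_ereal_sup => _ [p [pC pN] <-]; apply: ereal_sup_ubound.
exists (rot_field Q p).
  split; first exact: C1c_rot_field.
  by move=> y /pN; rewrite /rot_field -invN//; exact: SO_tr.
have := integral_mulmx Omega (fun x => ((- divergence p x) (u x))%:E) QQ => <-.
apply: eq_integral => y /set_mem Oy.
by rewrite (divergence_rot_field QQ oO pC Oy).
Qed.

Theorem proposition2 (R : realType) (d : nat) (V : completeNormedModType R)
    (Omega : set 'cV[R]_d) (N : dual_pow V d -> R) :
  open Omega -> bounded_set Omega ->
  product_norm N ->
  (forall (p : dual_pow V d) (Q : 'M[R]_d), SO Q -> N p = N (rot_dual Q p)) ->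
  forall (u : 'cV[R]_d -> V) (Q : 'M[R]_d),
    Lw_infty Omega u -> SO Q ->
    TV N Omega u =
    TV N [set Q^T *m x | x in Omega] (fun x => u (Q *m x)).
Proof.
move=> oO _ _ invN u Q _ SOQ; have SOQT := SO_tr SOQ; have [QQ _] := SOQ.
have -> : [set Q^T *m x | x in Omega] = mulmx Q @^-1` Omega.
  by rewrite image_mulmx ?trmxK// (mulmx1C QQ).
apply/eqP; rewrite eq_le le_TV_preimage_mulmx//=.
have oQ : open (mulmx Q @^-1` Omega).
  by apply: open_comp => // x _; exact: mulmx_continuous.
apply: le_trans (le_TV_preimage_mulmx _ oQ SOQT invN) _.
have -> : (fun x => u (Q *m (Q^T *m x))) = u.
  by apply/funext => x; rewrite mulmxA QQ mul1mx.
have -> // : mulmx Q^T @^-1` (mulmx Q @^-1` Omega) = Omega.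
by apply/seteqP; split => x; rewrite /preimage/= mulmxA QQ mul1mx.
Qed.
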